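(* Let $m\ge 3$ be an integer and let $c<m_2(K_m)=\frac{m+1}{2}$. There exist $M=M(m,c)$ and $\delta=\delta(m,c)>0$ such that the following holds. Let $H$ be a graph with $\chi(H)=m+1$ and $m_2(H)<c$, such that there is a subgraph $H_0\subseteq H$ with $v(H_0)\ge 3$, $\frac{e(H_0)-1}{v(H_0)-2}=m_2(H)$ and $v(H_0)>M$. If $p=p(n)\le n^{-\frac{1}{m_2(H)}+\delta}$ and $\binom{n}{m}p^{\binom{m}{2}}\to\infty$ as $n\to\infty$, then with high probability $$ex(G(n,p),K_m,H)=(1+o(1))\binom{n}{m}p^{\binom{m}{2}}.$$
   Context: $G(n,p)$ is the binomial random graph on $n$ labeled vertices with each pair an edge independently with probability $p$. For graphs $T,H$, $ex(G(n,p),T,H)$ is the random variable equal to the maximum number of copies of $T$ in an $H$-free subgraph of $G(n,p)$. ''With high probability'' means with probability tending to $1$ as $n\to\infty$. The 2-density is $m_2(H)=\max\{\frac{e(H')-1}{v(H')-2}: H'\subseteq H,\ v(H')\ge 3\}$. *)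

(* Defs.v *)
From HB Require Import structures.
From mathcomp Require Import all_boot all_order all_algebra.

Set Implicit Arguments.
Unset Strict Implicit.
Unset Printing Implicit Defensive.

Import Order.TTheory GRing.Theory Num.Theory.

(* A finite simple graph whose vertex set is a subset of the finite type V:
   a pair (vertex set, edge set), each edge being a 2-element set of vertices.
   Carrying the vertex set lets graphs, their (not necessarily spanning or
   induced) subgraphs, and copies of one graph in another share one type. *)
Definition sgraph_axiom (V : finType) (G : {set V} * {set {set V}}) : bool :=
  [forall e in G.2, (e \subset G.1) && (#|e| == 2)].

Record sgraph (V : finType) := SGraph {
  sgval : {set V} * {set {set V}};
  _ : sgraph_axiom sgval }.

HB.instance Definition _ (V : finType) := [isSub for @sgval V].
HB.instance Definition _ (V : finType) := [Finite of sgraph V by <:].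

Definition verts (V : finType) (G : sgraph V) : {set V} := (val G).1.
Definition edges (V : finType) (G : sgraph V) : {set {set V}} := (val G).2.

Definition subgraph (V : finType) (S G : sgraph V) : bool :=
  (verts S \subset verts G) && (edges S \subset edges G).

Lemma complete_proof (V : finType) :
  sgraph_axiom ([set: V], [set e : {set V} | #|e| == 2]).
Proof. by apply/forall_inP => e; rewrite inE /= subsetT. Qed.

Definition complete (V : finType) : sgraph V := SGraph (complete_proof V).

Definition graph_iso (V W : finType) (G : sgraph V) (G' : sgraph W) : bool :=
  [exists f : {ffun V -> W},
    [&& dinjectiveb f (mem (verts G)),
        f @: verts G == verts G' &
        [set f @: (e : {set V}) | e in edges G] == edges G']].

(* Copies are unlabelled: they are the subgraphs of G isomorphic to T. *)
Definition copies (V W : finType) (T : sgraph V) (G : sgraph W) :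
    {set sgraph W} :=
  [set S | subgraph S G && graph_iso T S].

Definition graph_free (V W : finType) (H : sgraph V) (G : sgraph W) : bool :=
  copies H G == set0.

Definition ex_copies (U V W : finType) (G : sgraph W) (T : sgraph U)
    (H : sgraph V) : nat :=
  \max_(S : sgraph W | subgraph S G && graph_free H S) #|copies T S|.

Definition colorable (V : finType) (G : sgraph V) (k : nat) : bool :=
  [exists f : {ffun {x : V | x \in verts G} -> 'I_k},
    [forall x, forall y, ([set val x; val y] \in edges G) ==> (f x != f y)]].

Lemma colorable_exists (V : finType) (G : sgraph V) :
  exists k, colorable G k.
Proof.
exists #|{: {x : V | x \in verts G}}|; apply/existsP.
exists [ffun x => enum_rank x]; apply/forallP => x; apply/forallP => y.
apply/implyP => xy; rewrite !ffunE (inj_eq enum_rank_inj).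
apply: contraTneq xy => ->; apply/negP => yy.
by have /forall_inP/(_ _ yy)/andP[_] := valP G; rewrite setUid cards1.
Qed.

Definition chromatic_number (V : finType) (G : sgraph V) : nat :=
  ex_minn (colorable_exists G).

From mathcomp Require Import ring lra.
From mathcomp Require Import all_classical all_reals all_analysis.
Import numFieldNormedType.Exports.

Local Open Scope ring_scope.

Definition density2 (R : realType) (V : finType) (G : sgraph V) : R :=
  (#|edges G|%:R - 1) / (#|verts G|%:R - 2).

(* The base value -1 is a lower bound for density2 on graphs with at least 3
   vertices, so this is the maximum whenever G has at least 3 vertices. *)
Definition m2 (R : realType) (V : finType) (G : sgraph V) : R :=
  \big[Num.max/-1]_(S : sgraph V | subgraph S G && (3 <= #|verts S|)%N)
    density2 R S.

Lemma card_edges_le (V : finType) (G : sgraph V) :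
  (#|edges G| <= 'C(#|verts G|, 2))%N.
Proof.
rewrite -cards_draws; apply: subset_leq_card; apply/fintype.subsetP => e eG.
by rewrite inE; exact: (forall_inP (valP G) e eG).
Qed.

Lemma m2_complete (R : realType) (m : nat) : (3 <= m)%N ->
  m2 R (complete 'I_m) = (m%:R + 1) / 2.
Proof.
move=> m3.
have binR k : 'C(k, 2)%:R = k%:R * (k%:R - 1) / 2 :> R.
  case: k => [|k]; first by rewrite bin0n mul0r mul0r.
  have := mul_bin_diag k.+1 1; rewrite bin1 /=.
  move=> /(congr1 (fun x : nat => x%:R : R)).
  rewrite !natrM => e.
  have e2 : k.+1%:R = k%:R + 1 :> R by rewrite natr1.
  rewrite e2 in e *. lra.
have mR : 3 <= m%:R :> R by rewrite (ler_nat _ 3).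
have gt0 k : (3 <= k)%N -> 0 < k%:R - 2 :> R.
  by move=> k3; have : 3 <= k%:R :> R; [rewrite (ler_nat _ 3)|lra].
apply/eqP; rewrite eq_le; apply/andP; split.
  apply: bigmax_le => [|S /andP[_ S3]]; first lra.
  rewrite /density2 ler_pdivrMr ?gt0 //.
  have vm : #|verts S|%:R <= m%:R :> R.
    by rewrite ler_nat; have := max_card (mem (verts S)); rewrite card_ord.
  have : #|edges S|%:R <= 'C(#|verts S|, 2)%:R :> R.
    by rewrite ler_nat card_edges_le.
  rewrite binR; have := gt0 _ S3; move: vm; nra.
have vK : #|verts (complete 'I_m)| = m by rewrite cardsT card_ord.
have eK : #|edges (complete 'I_m)| = 'C(m, 2).
  transitivity 'C(#|verts (complete 'I_m)|, 2)%N; last by rewrite vK.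
  rewrite -cards_draws; apply: eq_card => e.
  by rewrite !inE /= finset.subsetT.
have <- : density2 R (complete 'I_m) = (m%:R + 1) / 2.
  rewrite /density2 vK eK binR; field; have := gt0 _ m3; lra.
by apply: le_bigmax_cond; rewrite /subgraph !fintype.subxx vK.
Qed.

(* The law of G(n, p): each pair is an edge, independently, with
   probability p. *)
Definition gnp_weight (R : realType) (n : nat) (p : R) (G : sgraph 'I_n) : R :=
  if verts G == [set: 'I_n] then
    \prod_(e : {set 'I_n} | (#|e| == 2)%N) (if e \in edges G then p else 1 - p)
  else 0.

Definition gnp_prob (R : realType) (n : nat) (p : R) (A : pred (sgraph 'I_n)) :
    R :=
  \sum_(G : sgraph 'I_n | A G) gnp_weight p G.

Lemma gnp_total (R : realType) (n : nat) (p : R) :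
  gnp_prob p (fun G : sgraph 'I_n => true) = 1.
Proof.
pose A (e : {set 'I_n}) : R := if (#|e| == 2)%N then p else 0.
pose B (e : {set 'I_n}) : R := if (#|e| == 2)%N then 1 - p else 1.
have := @bigA_distr R 0 1 *%R +%R _ A B.
have -> : \prod_e (A e + B e) = 1.
  by rewrite big1 // => e _; rewrite /A /B; case: ifP => _; ring.
move=> /= ->.
rewrite /gnp_prob /gnp_weight -big_mkcond /=.
pose P (J : {set {set 'I_n}}) := [forall e in J, (#|e| == 2)%N].
rewrite (bigID P) /= [X in _ = _ + X]big1 ?addr0; last first.
  move=> J /forall_inPn [e eJ ne].
  by rewrite (bigD1 e) //= eJ /A (negbTE ne) mul0r.
have mk J : P J -> sgraph_axiom ([set: 'I_n], J).
  by move=> /forall_inP PJ; apply/forall_inP => e /PJ /= ->; rewrite finset.subsetT.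
rewrite (reindex_onto (@edges 'I_n)
  (fun J => insubd (complete 'I_n) ([set: 'I_n], J))); last first.
  by move=> J PJ; rewrite /edges val_insubd mk.
apply: eq_big => [G|G _] /=.
  apply/eqP/andP => [vG|[PG /eqP <-]].
    have PG : P (edges G).
      by apply/forall_inP => e eG; have /forall_inP/(_ _ eG)/andP[] := valP G.
    split=> //; apply/eqP/val_inj; rewrite val_insubd mk // -vG.
    by rewrite /verts /edges; case: (val G).
  by rewrite /verts val_insubd mk.
rewrite [RHS](bigID (fun e : {set 'I_n} => (#|e| == 2)%N)) /=.
rewrite [X in _ = _ * X]big1 ?mulr1.
  by apply: eq_bigr => e e2; rewrite /A /B e2.
move=> e ne; rewrite /A /B (negbTE ne); case: ifP => // eG.
by have /forall_inP/(_ _ eG)/andP[_] := valP G; rewrite (negbTE ne).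
Qed.

Local Open Scope classical_set_scope.

(* With high probability, X n (G(n, p n)) = (1 + o(1)) * a n. *)
Definition whp_asymptotic (R : realType) (p : nat -> R)
    (X : forall n : nat, sgraph 'I_n -> R) (a : nat -> R) : Prop :=
  forall eps : R, 0 < eps ->
    gnp_prob (p n) (fun G => `|X n G - a n| <= eps * a n)
      @[n --> \oo] --> (1 : R).

(* Main.v *)
(* The upper bound is the second moment method for the number of m-cliques.
   For the lower bound, delete every m-clique of G(n,p) that shares an edge with
   a copy of H_0 all of whose edges lie in m-cliques; the edges of the remaining
   cliques form an H-free graph, so it suffices that few cliques are deleted.

   Let F be the union of a copy of H_0 and cliques covering its edges, and let N
   be the number of edges of F outside H_0. An m-clique glued along at least two
   vertices adds at most 2/(m+1) vertices per new edge. Gluing onto H_0 gives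
   v(F) <= v(H_0) + 2N/(m+1). As H_0 is K_m-free, every clique contains one of
   the N new edges, so gluing onto their at most 2N endpoints gives
   v(F) <= 2N + 2 e(F)/(m+1); since e(H_0) < c v(H_0) with c < (m+1)/2, this
   forces N to be linear in v(H_0). With 1/m_2(H) > 1/c > 2/(m+1), each new edge
   costs a power of n, which for large v(H_0) beats the gain
   n^(delta e(H_0)). *)

Require Import Defs.
From mathcomp Require Import all_boot all_order all_algebra.
From mathcomp Require Import reals.
From mathcomp Require Import zify ring lra.

Set Implicit Arguments.
Unset Strict Implicit.
Unset Printing Implicit Defensive.

Import Order.TTheory GRing.Theory Num.Theory.

(** * Vertex and edge counts for unions of cliques *)

Definition pairs (T : finType) (K : {set T}) : {set {set T}} :=
  [set e : {set T} | (e \subset K) && (#|e| == 2)].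

Definition clique_edges (T : finType) (C : {set {set T}}) : {set {set T}} :=
  \bigcup_(K in C) pairs K.

Section Combinatorics.
Variable T : finType.
Implicit Types (A K e : {set T}) (E C : {set {set T}}).

Lemma card_pairs K : #|pairs K| = 'C(#|K|, 2).
Proof. by rewrite -cards_draws. Qed.

Lemma pairsI A K : pairs (A :&: K) = pairs A :&: pairs K.
Proof.
apply/setP => e; rewrite !inE subsetI.
by case: (e \subset A); case: (e \subset K); case: (_ == _).
Qed.

Lemma pairsS A K : A \subset K -> pairs A \subset pairs K.
Proof.
move=> AK; apply/subsetP => e; rewrite !inE => /andP[eA ->].
by rewrite (subset_trans eA AK).
Qed.

Lemma mem_pairs2 K x y : x \in K -> y \in K -> x != y -> [set x; y] \in pairs K.
Proof. by move=> xK yK xy; rewrite inE cards2 xy subUset !sub1set xK yK. Qed.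

Lemma pairs_card2 K e : e \in pairs K -> #|e| = 2.
Proof. by rewrite inE => /andP[_ /eqP]. Qed.

Lemma cover_pairs K : 2 <= #|K| -> cover (pairs K) = K.
Proof.
move=> K2; apply/eqP; rewrite eqEsubset; apply/andP; split.
  by apply/bigcupsP => e; rewrite inE => /andP[].
apply/subsetP => x xK.
have /card_gt0P[y] : 0 < #|K :\ x| by move: K2; rewrite (cardsD1 x) xK.
rewrite !inE => /andP[yx yK]; apply/bigcupP; exists [set x; y].
  by rewrite mem_pairs2 // eq_sym.
by rewrite !inE eqxx.
Qed.

Lemma card_cover_pairs E : (forall e, e \in E -> #|e| = 2) ->
  #|cover E| <= #|E|.*2.
Proof.
move=> E2; have /leq_trans -> // := leq_card_cover E.
rewrite (eq_bigr (fun _ => 2)) ?sum_nat_const ?muln2 // => e /E2 //.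
Qed.

(* Gluing an m-clique along j >= 2 vertices adds m - j vertices and at least
   (m - j)(m + j - 1)/2 >= (m - j)(m + 1)/2 edges. *)
Lemma glue_clique m A E K : E \subset pairs A -> #|K| = m ->
  2 <= #|K :&: A| ->
  m.+1 * #|A :|: K| + 2 * #|E| <= 2 * #|E :|: pairs K| + m.+1 * #|A|.
Proof.
move=> EA Km j2.
have jm : #|K :&: A| <= m by rewrite -Km subset_leq_card // subsetIl.
have cA := cardsUI A K; have cE := cardsUI E (pairs K).
have cI : #|E :&: pairs K| <= 'C(#|K :&: A|, 2).
  by rewrite -card_pairs pairsI setIC subset_leq_card // setIS.
rewrite card_pairs Km in cE; rewrite setIC Km in cA.
have bin2E k : 'C(k, 2).*2 = k * k.-1.
  by have := mul_bin_diag k 1; rewrite bin1 -mul2n; lia.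
move: cE cI (bin2E m) (bin2E #|K :&: A|); set j := #|K :&: A| in cA j2 jm *.
case: m j2 jm Km cA => [|m] /=; first by lia.
case: j => [|j] //= j2 jm _ cA cE cI bm bj.
have h1 : m.+1 * m + 2 * #|E| <= 2 * #|E :|: pairs K| + j.+1 * j.
  rewrite -bm -bj -!mul2n -!mulnDr leq_pmul2l // addnC -cE leq_add2l.
  exact: cI.
have h2 : #|A :|: K| = #|A| + (m - j) by lia.
have h4 : m.+2 * (m - j) + j.+1 * j <= m.+1 * m.
  have [d ->] : exists d, m = j + d by exists (m - j); lia.
  rewrite addKn; nia.
rewrite h2 mulnDr; lia.
Qed.

(** Glue the cliques one at a time and add up the inequalities of [glue_clique]. Each clique needs
    to meet only the initial [A] in two vertices, because the vertex set glued onto only grows. *)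
Lemma glue_cliques m A E C : E \subset pairs A ->
  (forall K, K \in C -> #|K| = m /\ 2 <= #|K :&: A|) ->
  m.+1 * #|A :|: cover C| + 2 * #|E|
    <= 2 * #|E :|: clique_edges C| + m.+1 * #|A|.
Proof.
move=> EA hC.
rewrite /cover /clique_edges -!big_enum /=.
have : forall K, K \in enum C -> #|K| = m /\ 2 <= #|K :&: A|.
  by move=> K; rewrite mem_enum; exact: hC.
move: (enum C) => s {C hC}; elim: s A E EA => [|K s IHs] A E EA hs.
  by rewrite !big_nil !setU0 addnC.
rewrite !big_cons !setUA.
have [Km Kj] := hs K (mem_head _ _).
have h1 := glue_clique EA Km Kj.
have EA' : E :|: pairs K \subset pairs (A :|: K).
  by rewrite subUset (subset_trans EA) ?pairsS ?subsetUl ?subsetUr.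
have /(IHs _ _ EA') h2 :
    forall L, L \in s -> #|L| = m /\ 2 <= #|L :&: (A :|: K)|.
  move=> L Ls; have [-> Lj] := hs L (mem_behead (s := K :: s) Ls); split=> //.
  by apply: leq_trans Lj (subset_leq_card _); rewrite setIS // subsetUl.
move: h1 h2; set u := #|A :|: K :|: _|; set v := #|E :|: pairs K :|: _|.
move: u v #|A| #|A :|: K| #|E| #|E :|: pairs K| => u v a b c d; lia.
Qed.

(** Both bounds on [cover C] come from gluing the same cliques onto different bases: first onto [E]
    with its endpoints, then onto the endpoints of the new edges, starting without edges. The first
    is good when [N] is small; the second shows that [N] cannot be too small. *)
Lemma covered_cliques_count m E C :
  (forall e, e \in E -> #|e| = 2) ->
  (forall K, K \in C -> [/\ #|K| = m, ~~ (pairs K \subset E) &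
     exists2 e, e \in E & e \subset K]) ->
  (forall e, e \in E -> exists2 K, K \in C & e \subset K) ->
  let N := #|clique_edges C :\: E| in
  [/\ #|clique_edges C| = #|E| + N,
      #|cover E| <= #|cover C|,
      m.+1 * #|cover C| <= 2 * N + m.+1 * #|cover E| &
      m.+1 * #|cover C| <= 2 * (#|E| + N) + m.+1 * (2 * N)].
Proof.
move=> E2 hC hE N.
have EC : E \subset clique_edges C.
  apply/subsetP => e eE; have [K KC eK] := hE e eE.
  by apply/bigcupP; exists K => //; rewrite inE eK E2 ?eqxx.
have cC : #|clique_edges C| = #|E| + N.
  by rewrite /N -(cardsID E) (setIidPr EC).
have covE : cover E \subset cover C.
  apply/bigcupsP => e eE; have [K KC eK] := hE e eE.
  by rewrite (subset_trans eK) // (bigcup_sup K).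
split=> //; first exact: subset_leq_card.
- have EA : E \subset pairs (cover E).
    by apply/subsetP => e eE; rewrite inE E2 ?eqxx ?(bigcup_sup e).
  have /(glue_cliques EA) :
      forall K, K \in C -> #|K| = m /\ 2 <= #|K :&: cover E|.
    move=> K KC; have [-> _ [e eE eK]] := hC K KC; split=> //.
    by rewrite -(E2 e eE) subset_leq_card // subsetI eK (bigcup_sup e).
  rewrite (setUidPr covE) (setUidPr EC) cC; lia.
(* No clique has all its pairs in [E], so each contains a new edge and hence meets [X] in two
   vertices. *)
pose X := cover (clique_edges C :\: E).
have X2 : #|X| <= 2 * N.
  rewrite mul2n card_cover_pairs // => e /setDP[/bigcupP[K _ eK] _].
  exact: pairs_card2 eK.
have XC : X \subset cover C.
  apply/bigcupsP => e /setDP[/bigcupP[K KC]]; rewrite inE => /andP[eK _] _.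
  by rewrite (subset_trans eK) // (bigcup_sup K).
have /(glue_cliques (sub0set (pairs X))) :
    forall K, K \in C -> #|K| = m /\ 2 <= #|K :&: X|.
  move=> K KC; have [-> /subsetPn[f fK fE] _] := hC K KC; split=> //.
  have fX : f \in clique_edges C :\: E.
    by rewrite inE fE; apply/bigcupP; exists K.
  rewrite -(pairs_card2 fK) subset_leq_card // subsetI (bigcup_sup f) //.
  by move: fK; rewrite inE => /andP[-> _].
rewrite (setUidPr XC) set0U cards0 cC => /leq_trans; rewrite muln0 addn0; apply.
by rewrite leq_add2l leq_mul2l X2 orbT.
Qed.

End Combinatorics.

(** * The choice of [M] and [delta] *)

Local Open Scope ring_scope.

(** With edge probability at most [n ^ -(1 / d - delta)], the last inequality says that a
    configuration with [vF] vertices and [e0 + N] edges has expected number of order at most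
    [1 / n]; this is the purpose of the [+ 1]. *)
Lemma exponent_gap (R : realType) (m : nat) (c : R) :
  0 < c -> c < (m%:R + 1) / 2 ->
  exists (M : nat) (delta : R), 0 < delta /\
    forall (d : R) (v0 e0 N vF : nat), 0 < d -> d < c ->
      (M < v0)%N -> (2 < v0)%N -> e0%:R - 1 = d * (v0%:R - 2) ->
      (v0 <= vF)%N -> (m.+1 * vF <= 2 * N + m.+1 * v0)%N ->
      (m.+1 * vF <= 2 * (e0 + N) + m.+1 * (2 * N))%N ->
      0 <= 1 / d - delta /\
      vF%:R + 1 <= (1 / d - delta) * (e0 + N)%:R.
Proof.
move=> c0 cm; set t := m%:R + 1 : R.
have t1 : 1 <= t by rewrite /t lerDr.
have tc : 2 * c < t by move: cm; rewrite -/t; lra.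
have tinv : 2 / t < 1 / c.
  by rewrite ltr_pdivrMr ?mul1r 1?mulrC ?ltr_pdivlMr //; lra.
(* A new edge gains [1 / d] and pays at most [2 / t] for vertices. Half of the gap between [1 / c]
   and [2 / t] is kept as net profit [eta] per new edge; the other half leaves room for [delta]. *)
pose eta := (1 / c - 2 / t) / 2.
have eta0 : 0 < eta by rewrite /eta; lra.
(* The second vertex bound gives [N] at least about [(t - 2 * c) / (2 + 2 * t) * v0], so [sigma] is
   the total profit of the new edges per vertex of the densest subgraph. The second term in the
   minimum below makes [delta * e0] cost at most half of it, up to a constant. *)
pose sigma := eta * (t - 2 * c) / (2 + 2 * t).
have sigma0 : 0 < sigma.
  by rewrite /sigma divr_gt0 ?mulr_gt0 //; lra.
pose delta := Num.min eta (sigma / (2 * c)).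
have dlt0 : 0 < delta.
  by rewrite /delta lt_min eta0 /= divr_gt0 // mulr_gt0.
have dle : delta <= eta by rewrite /delta ge_min lexx.
have dlc : delta * c <= sigma / 2.
  have : delta <= sigma / (2 * c) by rewrite /delta ge_min lexx orbT.
  by rewrite ler_pdivlMr ?mulr_gt0 //; lra.
(* The half of [sigma * v0] left over must absorb the constants: [3] from [v0 - 2] against [vF + 1],
   and one [eta] each from the bounds [Nge] and [de]. *)
have [M HM] : exists M : nat, 2 * (3 + 2 * eta) <= sigma * M%:R.
  exists (Num.trunc (sigma^-1 * (2 * (3 + 2 * eta)))).+1.
  by rewrite -ler_pdivrMl //; apply/ltW/truncnS_gt.
exists M, delta; split=> // d v0 e0 N vF d0 dc Mv v2 eq_e v0F h1 h2.
have dinv : 1 / c < 1 / d by rewrite !mul1r ltf_pV2 ?posrE.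
have theta0 : 0 <= 2 / t by rewrite divr_ge0 //; lra.
have aeta : eta <= 1 / d - delta - 2 / t by rewrite /eta in dle *; lra.
split; first lra.
have v2R : 3 <= v0%:R :> R by rewrite (ler_nat _ 3).
have MvR : M%:R <= v0%:R :> R by rewrite ler_nat ltnW.
have h0R : v0%:R <= vF%:R :> R by rewrite ler_nat.
have h1R : t * vF%:R <= 2 * N%:R + t * v0%:R.
  move: h1; rewrite -(ler_nat R) natrD !natrM -natr1 -/t; lra.
have h2R : t * vF%:R <= 2 * (e0%:R + N%:R) + t * (2 * N%:R).
  move: h2; rewrite -(ler_nat R) !(natrD, natrM) -natr1 -/t; lra.
rewrite natrD.
have e0le : e0%:R <= 1 + c * v0%:R.
  have -> : e0%:R = 1 + d * (v0%:R - 2) by rewrite -eq_e; ring.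
  by rewrite lerD2l; apply: ler_pM => //; lra.
have N0 : 0 <= N%:R :> R by [].
have tv : t * v0%:R <= t * vF%:R by rewrite ler_wpM2l //; lra.
have Nge : sigma * v0%:R - eta <= eta * N%:R.
  have step : (t - 2 * c) * v0%:R - 2 <= (2 + 2 * t) * N%:R by lra.
  have -> : sigma * v0%:R - eta
      = eta * (((t - 2 * c) * v0%:R - (2 + 2 * t)) / (2 + 2 * t)).
    by rewrite /sigma; field; lra.
  rewrite ler_pM2l // ler_pdivrMr; lra.
have aN : eta * N%:R <= (1 / d - delta - 2 / t) * N%:R by rewrite ler_wpM2r.
have e0d : e0%:R / d = 1 / d + v0%:R - 2.
  have -> : e0%:R = 1 + d * (v0%:R - 2) by rewrite -eq_e; ring.
  by field; lra.
have vFle : vF%:R <= v0%:R + 2 / t * N%:R.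
  have t0 : 0 < t by lra.
  rewrite -(ler_pM2l t0); apply: le_trans h1R _.
  by rewrite le_eqVlt; apply/orP; left; apply/eqP; field; lra.
have de : delta * e0%:R <= eta + sigma * v0%:R / 2.
  apply: le_trans (_ : delta * (1 + c * v0%:R) <= _).
    by rewrite ler_wpM2l // ltW.
  have : delta * c * v0%:R <= sigma / 2 * v0%:R by rewrite ler_wpM2r.
  by lra.
have sM : sigma * M%:R <= sigma * v0%:R by rewrite ler_wpM2l // ltW.
have did : 0 < 1 / d by rewrite divr_gt0.
(* The four terms are estimated by [e0d], [de], [aN] with [Nge], and [vFle]. *)
have -> : (1 / d - delta) * (e0%:R + N%:R)
  = e0%:R / d - delta * e0%:R + (1 / d - delta - 2 / t) * N%:R + 2 / t * N%:R.
  by field; lra.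
lra.
Qed.

(** * Consequences of 2-density for the densest subgraph and its copies *)

Definition sparse_edge_set (T : finType) (m v e : nat) (E : {set {set T}}) :=
  [&& #|E| == e, #|cover E| == v, [forall f in E, #|f| == 2%N] &
      [forall K : {set T}, (#|K| == m) ==> ~~ (pairs K \subset E)]].

Section Graphs.
Variable V : finType.
Implicit Types G H S : sgraph V.

Lemma edgesP G e : e \in edges G -> e \in pairs (verts G).
Proof. by move=> eG; rewrite inE; exact: (forall_inP (valP G) e eG). Qed.

Lemma cover_edges G : cover (edges G) \subset verts G.
Proof. by apply/bigcupsP => e /edgesP; rewrite inE => /andP[]. Qed.

Lemma sgraph_of_sets (A : {set V}) (E : {set {set V}}) : E \subset pairs A ->
  exists2 S, verts S = A & edges S = E.
Proof.
move=> /fintype.subsetP EA.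
have ax : sgraph_axiom (A, E).
  by apply/forall_inP => e /EA; rewrite inE.
by exists (SGraph ax).
Qed.

Lemma density2_le_m2 (R : realType) G S : subgraph S G -> (3 <= #|verts S|)%N ->
  density2 R S <= m2 R G.
Proof. by move=> SG S3; apply: le_bigmax_cond; rewrite SG. Qed.

Lemma card_edges_le_m2 (R : realType) G (A : {set V}) (E : {set {set V}}) :
  E \subset pairs A -> E \subset edges G -> A \subset verts G ->
  (3 <= #|A|)%N -> #|E|%:R - 1 <= m2 R G * (#|A|%:R - 2).
Proof.
move=> EA EG AG A3; have [S vS eS] := sgraph_of_sets EA.
rewrite -ler_pdivrMr; last first.
  by have : 3 <= #|A|%:R :> R; [rewrite (ler_nat _ 3)|lra].
rewrite -vS -eS; apply: density2_le_m2; rewrite ?vS //.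
by rewrite /subgraph vS eS AG EG.
Qed.

(** With at most one edge, giving one of its endpoints a colour of its own is a proper 2-colouring.
    Two edges are what makes [m2] positive in [m2_gt0]. *)
Lemma chromatic_number_gt2 G : (2 < chromatic_number G)%N -> (1 < #|edges G|)%N.
Proof.
rewrite /chromatic_number; case: ex_minnP => k _ kmin k3.
rewrite ltnNge; apply/negP => e1.
have /kmin : colorable G 2; last by rewrite leqNgt k3.
have [E0|[e eG]] := set_0Vmem (edges G).
  apply/existsP; exists [ffun=> ord0]; apply/forallP => x; apply/forallP => y.
  by rewrite E0 inE.
have /cards2P[a [b [ab eab]]] : #|e| == 2 by rewrite (pairs_card2 (edgesP eG)).
apply/existsP; exists [ffun x => if val x == a then ord0 else ord_max].
apply/forallP => x; apply/forallP => y; apply/implyP => xyG; rewrite !ffunE.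
have xy : val x != val y.
  apply: contraTneq (edgesP xyG) => ->; rewrite setUid.
  by apply/negP => /pairs_card2; rewrite cards1.
have : a \in [set val x; val y].
  by rewrite -(card_le1_eqP e1 _ _ xyG eG) eab !inE eqxx.
rewrite !inE => /orP[] /eqP aE; rewrite aE eqxx; last by rewrite (negbTE xy).
by rewrite [val y == _]eq_sym (negbTE xy).
Qed.

End Graphs.

Section SparseCopies.
Variables (R : realType) (m : nat) (V : finType) (H H0 : sgraph V).
Hypotheses (m3 : (3 <= m)%N) (H2 : (1 < #|edges H|)%N).
Hypothesis m2H : m2 R H < m2 R (complete 'I_m).
Hypotheses (H0H : subgraph H0 H) (H03 : (3 <= #|verts H0|)%N).
Hypothesis H0max : density2 R H0 = m2 R H.

Lemma card_edges_densest : #|edges H0|%:R - 1 = m2 R H * (#|verts H0|%:R - 2).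
Proof.
rewrite -H0max /density2 divfK // subr_eq0 (eqr_nat _ _ 2).
by rewrite gtn_eqF.
Qed.

Lemma m2_gt0 : 0 < m2 R H.
Proof.
have /andP[vH _] := H0H; have vH3 := leq_trans H03 (subset_leq_card vH).
apply: lt_le_trans (density2_le_m2 R (G := H) (S := H) _ vH3); last first.
  by rewrite /subgraph !subxx.
rewrite /density2 divr_gt0 // subr_gt0 ?(ltr_nat _ 1) ?(ltr_nat _ 2) //.
Qed.

Lemma card_edges_densest_gt0 : (0 < #|edges H0|)%N.
Proof.
have := card_edges_densest; have := m2_gt0.
have : 3 <= #|verts H0|%:R :> R by rewrite (ler_nat _ 3).
case: #|edges H0| => // v3 d0; nra.
Qed.

(** Deleting isolated vertices keeps all edges and would raise the density above the maximum. *)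
Lemma cover_densest : cover (edges H0) = verts H0.
Proof.
apply/eqP; rewrite eqEcard cover_edges /=.
have /andP[vH eH] := H0H; have eq0 := card_edges_densest; have d0 := m2_gt0.
have v3 : 3 <= #|verts H0|%:R :> R by rewrite (ler_nat _ 3).
have e2 : (1 < #|edges H0|)%N.
  by rewrite -(ltr_nat R) -subr_gt0 eq0 mulr_gt0 //; lra.
have sub : edges H0 \subset pairs (cover (edges H0)).
  apply/subsetP => e eH0; rewrite inE (bigcup_sup e) //=.
  by rewrite (pairs_card2 (edgesP eH0)).
(* The maximum in [m2] ranges over subgraphs with at least three vertices; two distinct edges
   already span that many. *)
have c3 : (2 < #|cover (edges H0)|)%N.
  rewrite ltnNge; apply/negP => c2.
  have := leq_trans e2 (subset_leq_card sub); rewrite card_pairs.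
  by case: #|cover _| c2 => [|[|[|]]].
have := card_edges_le_m2 R sub eH (subset_trans (cover_edges _) vH) c3.
by rewrite eq0 ler_pM2l // lerD2r ler_nat.
Qed.

(** An m-clique in [H0] would lie in [H] and force [m2 R H] to be at least [(m + 1) / 2]. *)
Lemma clique_free_densest (L : {set V}) :
  #|L| = m -> ~~ (pairs L \subset edges H0).
Proof.
move=> Lm; apply/negP => LH0; have /andP[vH eH] := H0H.
have LH : L \subset verts H.
  rewrite -(cover_pairs (K := L)) ?Lm; last exact: ltnW.
  apply/bigcupsP => e eL; have := edgesP (subsetP (subset_trans LH0 eH) _ eL).
  by rewrite inE => /andP[].
have := card_edges_le_m2 R (subxx _) (subset_trans LH0 eH) LH.
rewrite Lm card_pairs Lm => /(_ m3); apply/negP; rewrite -ltNge.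
have mR : 3 <= m%:R :> R by rewrite (ler_nat _ 3).
have -> : 'C(m, 2)%:R = m%:R * (m%:R - 1) / 2 :> R.
  have /(congr1 (fun x : nat => x%:R : R)) : (m * m.-1 = 2 * 'C(m, 2))%N.
    by have := mul_bin_diag m 1; rewrite bin1.
  rewrite !natrM -subn1 natrB; first by move=> ->; field.
  exact: leq_trans m3.
move: m2H; rewrite m2_complete // => m2c; nra.
Qed.

(** From here on the isomorphism type of a copy is forgotten. The larger family of sparse edge sets
    is harmless, since only upper bounds on its size are taken. *)
Lemma sparse_copy (W : finType) (G S : sgraph W) : S \in copies H0 G ->
  sparse_edge_set m #|verts H0| #|edges H0| (edges S).
Proof.
rewrite inE => /andP[_ /existsP[f /and3P[finj /eqP fV /eqP fE]]].
have {}finj : {in verts H0 &, injective f} by apply/dinjectiveP.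
have sub e : e \in edges H0 -> e \subset verts H0.
  by move=> /edgesP; rewrite inE => /andP[].
have imI (A B : {set V}) : A \subset verts H0 -> B \subset verts H0 ->
    f @: A = f @: B -> A = B.
  move=> AH BH AB; apply/setP => x; apply/idP/idP => xA.
    have /imsetP[y yB fxy] : f x \in f @: B by rewrite -AB imset_f.
    by rewrite (finj x y (subsetP AH _ xA) (subsetP BH _ yB) fxy).
  have /imsetP[y yB fxy] : f x \in f @: A by rewrite AB imset_f.
  by rewrite (finj x y (subsetP BH _ xA) (subsetP AH _ yB) fxy).
rewrite /sparse_edge_set -fE; apply/and4P; split.
- by apply/eqP; apply: card_in_imset => A B AE BE; apply: imI; exact: sub.
- suff -> : cover [set f @: e | e : {set V} in edges H0] = f @: verts H0.
    by rewrite card_in_imset.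
  rewrite -cover_densest; apply/setP => y; apply/bigcupP/imsetP.
    case=> _ /imsetP[e eH ->] /imsetP[x xe ->]; exists x => //.
    by apply/bigcupP; exists e.
  case=> x /bigcupP[e eH xe] ->; exists (f @: e); first exact: imset_f.
  exact: imset_f.
- apply/forall_inP => _ /imsetP[e eH ->]; rewrite card_in_imset.
    by rewrite (pairs_card2 (edgesP eH)).
  by move=> x y xe ye; apply: finj; exact: (subsetP (sub e eH)).
apply/forall_inP => K /eqP Km; apply/negP => KS.
(* Pull a clique of the copy back to [H0]. The map is injective on [verts H0] only, hence the
   restriction. Each vertex of [K] lies on an edge of [K], which is the image of an edge of [H0], so
   [L] maps onto [K]. *)
pose L := [set x in verts H0 | f x \in K].
have LH : L \subset verts H0 by apply/subsetP => x; rewrite inE => /andP[].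
have fL : f @: L = K.
  apply/eqP; rewrite eqEsubset; apply/andP; split.
    by apply/subsetP => y /imsetP[x + ->]; rewrite inE => /andP[].
  rewrite -{1}(cover_pairs (K := K)) ?Km; last exact: ltnW.
  apply/subsetP => y /bigcupP[e eK ye].
  have /imsetP[e' e'H eE] := subsetP KS e eK.
  move: ye; rewrite eE => /imsetP[x xe' yx]; apply/imsetP; exists x => //.
  rewrite inE (subsetP (sub _ e'H)) //= -yx.
  have : y \in e by rewrite eE yx imset_f.
  by move: eK; rewrite inE => /andP[/subsetP eK _] /eK.
have Lm : #|L| = m.
  rewrite -Km -fL card_in_imset // => x y xL yL.
  apply: finj; exact: (subsetP LH).
have /negP[] := clique_free_densest Lm.
apply/subsetP => e eL.
have eLs : e \subset L by move: eL; rewrite inE => /andP[].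
have /(subsetP KS)/imsetP[e' e'H e'E] : f @: e \in pairs K.
  rewrite inE -{1}fL imsetS //= card_in_imset ?(pairs_card2 eL) //.
  by move=> x y xe ye; apply: finj; apply: (subsetP LH); exact: (subsetP eLs).
by rewrite (imI _ _ (subset_trans eLs LH) (sub _ e'H) e'E).
Qed.

End SparseCopies.

(* Cliques, copies and the deletion argument *)
Local Close Scope ring_scope.

Definition cliques (V : finType) (m : nat) (G : sgraph V) : {set {set V}} :=
  [set K : {set V} | (#|K| == m) && (pairs K \subset edges G)].

Lemma sgraph_eq (V : finType) (G G' : sgraph V) :
  verts G = verts G' -> edges G = edges G' -> G = G'.
Proof.
rewrite /verts /edges => v e; apply: val_inj; move: v e.
by case: (val G) => ? ?; case: (val G') => ? ? /= -> ->.
Qed.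

Lemma imset_pairs (U V : finType) (f : U -> V) : injective f ->
  [set f @: (e : {set U}) | e in edges (complete U)] = pairs (f @: [set: U]).
Proof.
move=> finj; apply/setP => e; apply/imsetP/idP.
  case=> e'; rewrite inE => e'2 ->.
  by rewrite inE imsetS ?subsetT //= card_imset.
rewrite inE => /andP[eU e2]; have eE : e = f @: (f @^-1: e).
  apply/setP => y; apply/idP/imsetP => [ye|[x]]; last by rewrite inE => ? ->.
  by have /imsetP[x _ yx] := subsetP eU y ye; exists x; rewrite // inE -yx.
exists (f @^-1: e) => //; rewrite inE -(card_imset _ finj).
by move: e2; rewrite {1}eE.
Qed.

Lemma graph_iso_complete (V : finType) (m : nat) (S : sgraph V) :
  graph_iso (complete 'I_m) S
  = (#|verts S| == m) && (edges S == pairs (verts S)).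
Proof.
apply/existsP/andP.
  case=> f /and3P[/dinjectiveP finj /eqP fV /eqP fE].
  have {}finj : injective f by move=> x y; apply: finj; rewrite inE.
  by rewrite -fV -fE imset_pairs //= card_imset // cardsT card_ord.
case=> /eqP Sm /eqP SE.
pose f := [ffun i : 'I_m => enum_val (cast_ord (esym Sm) i)].
have finj : injective f.
  by move=> i j; rewrite !ffunE => /enum_val_inj /cast_ord_inj.
have fS : f @: [set: 'I_m] = verts S.
  apply/eqP; rewrite eqEcard card_imset // cardsT card_ord Sm leqnn andbT.
  by apply/subsetP => _ /imsetP[i _ ->]; rewrite ffunE enum_valP.
exists f; apply/and3P; split.
- by apply/dinjectiveP => x y _ _; apply: finj.
- by rewrite fS.
- by rewrite SE -fS imset_pairs.
Qed.

(** A copy of the complete graph is determined by its vertex set. For [1 < m] the pairs of a clique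
    cover it, which puts the clique inside [verts G]. *)
Lemma card_copies_complete (V : finType) (m : nat) (G : sgraph V) : 1 < m ->
  #|copies (complete 'I_m) G| = #|cliques m G|.
Proof.
move=> m1; have <- : @verts V @: copies (complete 'I_m) G = cliques m G.
  apply/setP => K; rewrite inE; apply/imsetP/andP.
    case=> S; rewrite inE graph_iso_complete => /and3P[/andP[_ SG]].
    by move=> Sm /eqP SE ->; rewrite -SE.
  case=> Km KG; have [S vS eS] := sgraph_of_sets (subxx (pairs K)).
  exists S; rewrite // inE graph_iso_complete /subgraph vS eS Km KG eqxx !andbT.
  rewrite -(cover_pairs (K := K)) ?(eqP Km) //.
  apply/bigcupsP => e /(subsetP KG) /edgesP.
  by rewrite inE => /andP[].
rewrite card_in_imset // => S S'; rewrite !inE !graph_iso_complete.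
move=> /and3P[_ _ /eqP SE] /and3P[_ _ /eqP SE'] SS'.
by apply: sgraph_eq; rewrite // SE SE' SS'.
Qed.

(** An embedding of [H] restricts to an embedding of [H0]. *)
Lemma graph_free_sub (V W : finType) (H H0 : sgraph V) (G : sgraph W) :
  subgraph H0 H -> graph_free H0 G -> graph_free H G.
Proof.
move=> /andP[vH eH] /eqP free; apply/eqP/setP => S; rewrite inE [RHS]inE.
apply/negP => /andP[/andP[vS eS] /existsP[f]].
case/and3P=> /dinjectiveP finj /eqP fV /eqP fE.
have fP : [set f @: (e : {set V}) | e in edges H0]
    \subset pairs (f @: verts H0).
  apply/subsetP => _ /imsetP[e eH0 ->]; have := edgesP eH0.
  rewrite !inE => /andP[eH0' /eqP e2]; rewrite imsetS //= card_in_imset ?e2 //.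
  move=> x y xe ye; apply: finj; apply: (subsetP vH); exact: (subsetP eH0').
have [S0 vS0 eS0] := sgraph_of_sets fP.
suff : S0 \in copies H0 G by rewrite free inE.
rewrite inE /subgraph vS0 eS0 (subset_trans _ vS) -?fV ?imsetS //=.
rewrite (subset_trans _ eS) -?fE ?imsetS //=.
apply/existsP; exists f; rewrite vS0 eS0 !eqxx !andbT.
apply/dinjectiveP => x y xH yH; apply: finj; exact: (subsetP vH).
Qed.

Lemma ex_copies_le (U V W : finType) (G : sgraph W) (T : sgraph U)
  (H : sgraph V) : ex_copies G T H <= #|copies T G|.
Proof.
apply/bigmax_leqP => S /andP[/andP[vS eS] _]; apply: subset_leq_card.
apply/subsetP => S'; rewrite !inE => /andP[/andP[vS' eS'] ->].
by rewrite /subgraph (subset_trans vS') ?(subset_trans eS').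
Qed.

(* Configurations (E, C): a would-be copy of H_0 with edge set E, together with
   m-cliques C that cover all of its edges. *)
Definition clique_covered (T : finType) (m v e : nat)
    (EC : {set {set T}} * {set {set T}}) :=
  [&& sparse_edge_set m v e EC.1, #|EC.2| <= e,
      [forall K in EC.2, (#|K| == m) && [exists f in EC.1, f \subset K]] &
      [forall f in EC.1, [exists K in EC.2, f \subset K]]].

Definition covered_copies (T : finType) (m v e : nat) (G : sgraph T) :=
  [set EC | clique_covered m v e EC & clique_edges EC.2 \subset edges G].

(* Discard every clique taking part in a configuration: the remaining cliques
   span an H-free graph. *)
Lemma ex_copies_ge (V W : finType) (m v e : nat) (H H0 : sgraph V)
    (G : sgraph W) :
  1 < m -> 0 < e -> subgraph H0 H -> verts G = [set: W] ->
  (forall S S' : sgraph W, S' \in copies H0 S ->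
     sparse_edge_set m v e (edges S')) ->
  #|cliques m G|
  <= ex_copies G (complete 'I_m) H + #|covered_copies m v e G| * e.
Proof.
move=> m1 e0 H0H vG sparse.
pose Z := \bigcup_(EC in covered_copies m v e G) EC.2.
pose good := cliques m G :\: Z.
have Zle : #|Z| <= #|covered_copies m v e G| * e.
  apply: leq_trans (_ : \sum_(EC in covered_copies m v e G) #|EC.2| <= _).
    rewrite /Z; elim/big_rec2: _ => [|EC k A _ IH]; first by rewrite cards0.
    by rewrite (leq_trans (leq_card_setU _ _)) // leq_add2l.
  rewrite -sum_nat_const leq_sum // => EC.
  by rewrite inE => /andP[/and4P[]].
have goodG : clique_edges good \subset edges G.
  by apply/bigcupsP => K; rewrite !inE => /and3P[].
have [S vS eS] := sgraph_of_sets
  (subset_trans goodG (introT subsetP (@edgesP _ G))).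
have SG : subgraph S G by rewrite /subgraph vS eS subxx.
suff free : graph_free H S.
  apply: leq_trans (leq_add (leqnn _) Zle); rewrite addnC -leq_subLR.
  apply: leq_trans (_ : #|good| <= _).
    by rewrite cardsD leq_sub2l // subset_leq_card // subsetIr.
  apply: leq_trans (_ : #|copies (complete 'I_m) S| <= _); last first.
    by apply: (bigop.bigmax_sup S); rewrite // SG free.
  rewrite card_copies_complete // subset_leq_card //; apply/subsetP => K Kg.
  have: K \in good by []. rewrite !inE => /andP[_ /andP[-> _]] /=.
  by rewrite eS (bigcup_sup K).
apply: graph_free_sub H0H _; apply/eqP/setP => S'; rewrite [RHS]inE.
apply/negP => S'S; have := sparse _ _ S'S => /[dup] sp /and4P[/eqP Ee _ _ _].
have subS : edges S' \subset clique_edges good.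
  by move: S'S; rewrite inE -eS => /andP[/andP[]].
(* One surviving clique is chosen for each edge of the supposed copy. The at most [e] chosen cliques
   form a configuration, so they should have been discarded. The default [set0] is never reached on
   these edges. *)
pose psi (f : {set W}) := odflt set0 [pick K in good | f \subset K].
have psiP f : f \in edges S' -> psi f \in good /\ f \subset psi f.
  move=> /(subsetP subS)/bigcupP[K Kg]; rewrite inE => /andP[fK _].
  rewrite /psi; case: pickP => [K' /andP[]|/(_ K)] //.
  by rewrite fK andbT (Kg : (K \in good) = true).
pose C := psi @: edges S'.
have CG K : K \in C -> K \in good /\ exists2 f, f \in edges S' & f \subset K.
  by move=> /imsetP[f fS' ->]; have [pg fp] := psiP f fS'; split=> //; exists f.
have cov : (edges S', C) \in covered_copies m v e G.
  rewrite inE; apply/andP; split; last first.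
    apply/bigcupsP => K /CG[]; rewrite inE => /andP[_].
    by rewrite inE => /andP[].
  apply/and4P; split => //=.
  - by rewrite -Ee leq_imset_card.
  - apply/forall_inP => K /CG[]; rewrite inE => /andP[_].
    rewrite inE => /andP[-> _] [f fS' fK] /=; apply/existsP; exists f.
    by rewrite fS'.
  - apply/forall_inP => f fS'; apply/existsP; exists (psi f).
    by rewrite imset_f //=; case: (psiP f fS').
have /card_gt0P[f fS'] : 0 < #|edges S'| by rewrite Ee.
have [/setDP[_ /negP nZ] _] := psiP f fS'; case: nZ.
by apply/bigcupP; exists (edges S', C) => //=; rewrite imset_f.
Qed.

(** * Expectation and tail bounds in the binomial random graph *)

Local Open Scope ring_scope.

Definition gnp_expect (R : realType) (n : nat) (p : R) (f : sgraph 'I_n -> R) :=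
  \sum_(G : sgraph 'I_n) gnp_weight p G * f G.

Section Gnp.
Variables (R : realType) (n : nat) (p : R).
Hypothesis p01 : 0 <= p <= 1.
Implicit Types (f g : sgraph 'I_n -> R) (D : {set {set 'I_n}}).

Lemma gnp_weight_ge0 (G : sgraph 'I_n) : 0 <= gnp_weight p G.
Proof.
rewrite /gnp_weight; case: ifP => // _; apply: prodr_ge0 => e _.
by case: ifP => _; rewrite ?subr_ge0; case/andP: p01.
Qed.

Lemma gnp_expectD f g :
  gnp_expect p (fun G : sgraph 'I_n => f G + g G)
  = gnp_expect p f + gnp_expect p g.
Proof. by rewrite -big_split; apply: eq_bigr => G _; rewrite mulrDr. Qed.

Lemma gnp_expectZ (a : R) f :
  gnp_expect p (fun G : sgraph 'I_n => a * f G) = a * gnp_expect p f.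
Proof. by rewrite mulr_sumr; apply: eq_bigr => G _; rewrite mulrCA. Qed.

Lemma gnp_expect_cst (a : R) : gnp_expect (n := n) p (fun=> a) = a.
Proof.
rewrite /gnp_expect -mulr_suml -[X in X * _]/(gnp_prob p predT).
by rewrite gnp_total mul1r.
Qed.

Lemma gnp_expect_sum (I : finType) (P : pred I) (f : I -> sgraph 'I_n -> R) :
  gnp_expect p (fun G : sgraph 'I_n => \sum_(i | P i) f i G)
    = \sum_(i | P i) gnp_expect p (f i).
Proof.
by rewrite exchange_big; apply: eq_bigr => G _; rewrite mulr_sumr.
Qed.

Lemma gnp_prob_markov (a : R) f : 0 < a -> (forall G, 0 <= f G) ->
  gnp_prob p (fun G => a <= f G) <= gnp_expect p f / a.
Proof.
move=> a0 f0; rewrite ler_pdivlMr // /gnp_prob mulr_suml /gnp_expect.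
rewrite [leRHS](bigID (fun G => a <= f G)) /= -[leLHS]addr0 lerD //.
  by apply: ler_sum => G aG; rewrite ler_wpM2l ?gnp_weight_ge0.
by apply: sumr_ge0 => G _; rewrite mulr_ge0 ?gnp_weight_ge0.
Qed.

Lemma gnp_prob_le1 (A : pred (sgraph 'I_n)) : gnp_prob p A <= 1.
Proof.
rewrite -(gnp_total n p) /gnp_prob [leRHS](bigID A) /= lerDl.
by apply: sumr_ge0 => G _; exact: gnp_weight_ge0.
Qed.

(** This is a union bound over two bad events. Graphs that do not span all vertices have weight
    zero, so the implication is asked of spanning graphs only. *)
Lemma gnp_prob_ge (A B1 B2 : pred (sgraph 'I_n)) :
  (forall G, verts G = [set: 'I_n] -> ~~ B1 G -> ~~ B2 G -> A G) ->
  1 - gnp_prob p B1 - gnp_prob p B2 <= gnp_prob p A.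
Proof.
move=> BA; rewrite -(gnp_total n p) !lerBlDr /gnp_prob.
rewrite (big_mkcond A) (big_mkcond B1) (big_mkcond B2) /=.
rewrite -!big_split /=; apply: ler_sum => G _.
have w0 := gnp_weight_ge0 G.
have [vG|vG] := eqVneq (verts G) [set: 'I_n]; last first.
  have -> : gnp_weight p G = 0 by rewrite /gnp_weight (negbTE vG).
  by rewrite !if_same !addr0.
have := BA G vG; case: (A G); case: (B1 G); case: (B2 G) => //= h; lra.
Qed.

(** Expand the product of [A e + B e] over all vertex sets [e]; the chosen factors [A] form the edge
    set [J]. Taking [B] zero on [D] removes every [J] that misses an element of [D], and taking [A]
    zero on non-pairs removes every [J] that is not an edge set. *)
Lemma gnp_expect_edges D : (forall e, e \in D -> #|e| = 2) ->
  gnp_expect p (fun G : sgraph 'I_n => (D \subset edges G)%:R) = p ^+ #|D|.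
Proof.
move=> D2; pose A (e : {set 'I_n}) : R := if (#|e| == 2)%N then p else 0.
pose B (e : {set 'I_n}) : R :=
  if e \in D then 0 else if (#|e| == 2)%N then 1 - p else 1.
have := @bigA_distr R 0 1 *%R +%R _ A B.
have -> : \prod_e (A e + B e) = p ^+ #|D|.
  rewrite -prodr_const [RHS]big_mkcond /=; apply: eq_bigr => e _; rewrite /A /B.
  have [eD|eD] := boolP (e \in D); first by rewrite (D2 e eD) eqxx addr0.
  by case: ifP => _; ring.
move=> /= ->.
pose P (J : {set {set 'I_n}}) := [forall e in J, (#|e| == 2)%N].
rewrite (bigID P) /= [X in _ = _ + X]big1 ?addr0; last first.
  move=> J /forall_inPn [e eJ ne].
  by rewrite (bigD1 e) //= eJ /A (negbTE ne) mul0r.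
have mk J : P J -> sgraph_axiom ([set: 'I_n], J).
  by move=> /forall_inP PJ; apply/forall_inP => e /PJ /= ->; rewrite subsetT.
rewrite (reindex_onto (@edges 'I_n)
  (fun J => insubd (complete 'I_n) ([set: 'I_n], J))); last first.
  by move=> J PJ; rewrite /edges val_insubd mk.
rewrite /gnp_expect (bigID (fun G => verts G == [set: 'I_n])) /=.
rewrite [X in _ + X]big1 ?addr0; last first.
  by move=> G /negbTE vG; rewrite /gnp_weight vG mul0r.
apply: eq_big => [G|G vG] /=.
  apply/eqP/andP => [vG|[PG /eqP <-]].
    have PG : P (edges G).
      by apply/forall_inP => e /edgesP /pairs_card2 ->.
    split=> //; apply/eqP/val_inj; rewrite val_insubd mk // -vG.
    by rewrite /verts /edges; case: (val G).
  by rewrite /verts val_insubd mk.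
rewrite /gnp_weight vG; have [DG|/subsetPn[e eD eG]] := boolP (D \subset _).
  rewrite mulr1 big_mkcond; apply: eq_bigr => e _; rewrite /A /B.
  case: ifP => [e2|/negbT e2].
    by case: ifP => // eG; rewrite ifN //; apply: contraFN eG => /(subsetP DG).
  rewrite !ifN //; apply: contraNN e2; first by move=> /D2 ->.
  by move=> /edgesP /pairs_card2 ->.
by rewrite mulr0 (bigD1 e) //= (negbTE eG) /B eD mul0r.
Qed.

Lemma gnp_expect_covered (m v e : nat) :
  gnp_expect p (fun G : sgraph 'I_n => #|covered_copies m v e G|%:R)
  = \sum_(EC | clique_covered m v e EC)
      p ^+ #|clique_edges (EC.2 : {set {set 'I_n}})|.
Proof.
transitivity (gnp_expect p (fun G : sgraph 'I_n =>
    \sum_(EC | clique_covered m v e EC)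
      (clique_edges EC.2 \subset edges G)%:R)).
  apply: eq_bigr => G _; congr (_ * _).
  rewrite -sum1_card natr_sum big_mkcond [RHS]big_mkcond /=.
  apply: eq_bigr => EC _; rewrite inE.
  by case: clique_covered; case: (_ \subset _).
rewrite gnp_expect_sum; apply: eq_bigr => EC _.
by rewrite gnp_expect_edges // => f /bigcupP[K _ /pairs_card2].
Qed.

Definition msets (m : nat) : {set {set 'I_n}} :=
  [set K : {set 'I_n} | #|K| == m]%N.

Lemma gnp_expect_cliques (m : nat) :
  gnp_expect p (fun G : sgraph 'I_n => #|cliques m G|%:R)
  = 'C(n, m)%:R * p ^+ 'C(m, 2).
Proof.
transitivity (gnp_expect p (fun G : sgraph 'I_n => \sum_(K in msets m)
    (pairs K \subset edges G)%:R)).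
  apply: eq_bigr => G _; congr (_ * _).
  rewrite -sum1_card natr_sum big_mkcond [RHS]big_mkcond /=.
  by apply: eq_bigr => K _; rewrite !inE; case: (_ == m); case: (_ \subset _).
rewrite gnp_expect_sum (eq_bigr (fun=> p ^+ 'C(m, 2))); last first.
  move=> K; rewrite inE => /eqP Km.
  by rewrite gnp_expect_edges ?card_pairs ?Km // => f /pairs_card2.
rewrite sumr_const; rewrite -[n in 'C(n, m)]card_ord -card_draws mulr_natl.
by congr (_ *+ _).
Qed.

Lemma gnp_expect_cliques2 (m : nat) :
  gnp_expect p (fun G : sgraph 'I_n => #|cliques m G|%:R ^+ 2)
  = \sum_(K in msets m) \sum_(L in msets m) p ^+ #|pairs K :|: pairs L|.
Proof.
transitivity (gnp_expect p (fun G : sgraph 'I_n =>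
    \sum_(K in msets m) \sum_(L in msets m)
      (pairs K :|: pairs L \subset edges G)%:R)).
  apply: eq_bigr => G _; congr (_ * _).
  have -> : #|cliques m G|%:R
      = \sum_(K in msets m) (pairs K \subset edges G)%:R :> R.
    rewrite -sum1_card natr_sum big_mkcond [RHS]big_mkcond /=.
    by apply: eq_bigr => K _; rewrite !inE; case: (_ == m); case: (_ \subset _).
  rewrite expr2 mulr_suml; apply: eq_bigr => K _.
  rewrite mulr_sumr; apply: eq_bigr => L _.
  by rewrite subUset -natrM mulnb.
rewrite gnp_expect_sum; apply: eq_bigr => K _.
rewrite gnp_expect_sum; apply: eq_bigr => L _.
by rewrite gnp_expect_edges // => f /setUP[] /pairs_card2.
Qed.

End Gnp.

(** * Binomial estimates and the enumeration of configurations *)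

Section Counting.
Local Open Scope nat_scope.

Lemma ffact_le_exp n k : n ^_ k <= n ^ k.
Proof.
elim: k n => // k IHk [|n] //; rewrite ffactSS expnS leq_mul2l.
by case: k {IHk} (IHk n) => // k /leq_trans ->; rewrite ?orbT // leq_exp2r.
Qed.

Lemma bin_le_exp n k : 'C(n, k) <= n ^ k.
Proof.
by apply: leq_trans (ffact_le_exp n k); rewrite -bin_ffact leq_pmulr ?fact_gt0.
Qed.

Lemma exp_sub_le_ffact n k : (n - k) ^ k <= n ^_ k.
Proof.
elim: k n => // k IHk [|n]; first by rewrite sub0n exp0n.
by rewrite ffactSS subSS expnS leq_mul // leqW // leq_subr.
Qed.

(** Every factor of the falling factorial is at least [n - m], hence at least half of [n]. *)
Lemma exp_le_bin n m : m.*2 <= n -> n ^ m <= 2 ^ m * m`! * 'C(n, m).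
Proof.
move=> mn; rewrite -mulnA [m`! * _]mulnC bin_ffact.
apply: leq_trans (leq_mul (leqnn _) (exp_sub_le_ffact n m)).
by rewrite -expnMn; case: m mn => // m mn; rewrite leq_exp2r //; lia.
Qed.

(** Sort the sets [L] by [J], their intersection with [K]. At most [n ^ (#|K| - #|J|)] of them share
    a given [J], so each of the [2 ^ #|K|] choices of [J] contributes at most [n ^ #|K|]. *)
Lemma sum_exp_card_meet n (K : {set 'I_n}) :
  \sum_(L in msets n #|K|) n ^ #|K :&: L| <= 2 ^ #|K| * n ^ #|K|.
Proof.
rewrite (partition_big (fun L => K :&: L) (mem (powerset K))) /=; last first.
  by move=> L _; rewrite inE subsetIl.
rewrite -card_powerset -sum_nat_const; apply: leq_sum => J.
rewrite inE => JK; rewrite (eq_bigr (fun=> n ^ #|J|)); last first.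
  by move=> L /andP[_ /eqP ->].
have Jm := subset_leq_card JK.
rewrite sum_nat_const -[X in _ <= n ^ X](subnK Jm) expnD leq_mul2r.
apply/orP; right; apply: leq_trans (bin_le_exp _ _).
rewrite -[n in 'C(n, _)]card_ord -card_draws.
rewrite -(card_in_imset (f := fun L => L :\: J)); last first.
  move=> L L' /andP[_ /eqP LJ] /andP[_ /eqP L'J] LL'.
  have sub (M : {set 'I_n}) : K :&: M = J -> M :&: J = J.
    by move=> <-; rewrite setICA setIid.
  by rewrite -[L](setID _ J) -[L'](setID _ J) LL' !sub.
apply/subset_leq_card/subsetP => _ /imsetP[L /andP[Lm /eqP LJ] ->].
rewrite inE in Lm; rewrite inE cardsD (eqP Lm).
have /setIidPr -> // : J \subset L by rewrite -LJ subsetIr.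
Qed.

(** Both components of a configuration are families of subsets of [U], so the count is bounded
    independently of [n]. *)
Lemma card_clique_covered n (m v e : nat) (U : {set 'I_n}) : #|U| <= m * e ->
  #|[set EC | clique_covered m v e EC & cover EC.2 == U]|
    <= 2 ^ 2 ^ (m * e) * 2 ^ 2 ^ (m * e).
Proof.
move=> Ue; pose PP := powerset (powerset U).
apply: leq_trans (_ : #|setX PP PP| <= _).
  apply/subset_leq_card/subsetP => -[E C]; rewrite !inE /=.
  case/andP=> /and4P[_ _ _ /forall_inP /= EC] /eqP CU.
  apply/andP; split; apply/subsetP => f; rewrite inE.
    move=> /EC/existsP[K /andP[KC fK]].
    by rewrite (subset_trans fK) // -CU (bigcup_sup K).
  by move=> fC; rewrite -CU (bigcup_sup f).
by rewrite cardsX !card_powerset leq_mul // leq_exp2l // leq_exp2l.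
Qed.

Lemma card_cover_clique_covered n (m v e : nat)
    (EC : {set {set 'I_n}} * {set {set 'I_n}}) :
  clique_covered m v e EC -> #|cover EC.2| <= m * e.
Proof.
case/and4P=> _ Ce /forall_inP CK _.
apply: leq_trans (leq_card_cover _) _.
rewrite (eq_bigr (fun=> m)) => [|K /CK /andP[/eqP ->] //].
by rewrite sum_nat_const mulnC leq_mul2l Ce orbT.
Qed.

End Counting.

(** * First moment of configurations and variance of the clique count *)

Section Moments.
Variables (R : realType) (n : nat) (p : R).
Hypothesis p01 : 0 <= p <= 1.
Hypothesis n0 : (0 < n)%N.

(** Group configurations by their vertex set [U]. The weight cancels the at most [n ^ k] choices of
    a [U] of size [k], leaving a constant for each of the [(m * e).+1] possible sizes. *)
Lemma sum_clique_covered (m v e : nat) :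
  \sum_(EC | clique_covered m v e EC)
     (n%:R ^+ #|cover (EC.2 : {set {set 'I_n}})|)^-1
  <= ((m * e).+1 * (2 ^ 2 ^ (m * e) * 2 ^ 2 ^ (m * e)))%:R :> R.
Proof.
have nR : 0 < n%:R :> R by rewrite ltr0n.
set c := (2 ^ 2 ^ (m * e) * 2 ^ 2 ^ (m * e))%N.
rewrite (partition_big (fun EC => cover EC.2)
  (fun U : {set 'I_n} => #|U| <= m * e)%N) /=; last first.
  by move=> EC; exact: card_cover_clique_covered.
apply: le_trans (_ : \sum_(U : {set 'I_n} | (#|U| <= m * e)%N)
  c%:R * (n%:R ^+ #|U|)^-1 <= _).
  apply: ler_sum => U Ue.
  rewrite (eq_bigr (fun=> (n%:R ^+ #|U|)^-1)); last first.
    by move=> EC /andP[_ /eqP ->].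
  rewrite sumr_const -[leLHS]mulr_natl ler_wpM2r ?invr_ge0 ?exprn_ge0 //.
  rewrite ler_nat.
  apply: leq_trans (card_clique_covered v Ue).
  by rewrite subset_leq_card //; apply/subsetP => EC; rewrite inE.
rewrite -mulr_sumr [in leRHS]mulnC natrM ler_wpM2l //.
rewrite (partition_big
  (fun U : {set 'I_n} => inord #|U| : 'I_(m * e).+1) predT) //=.
have -> : (m * e).+1%:R = \sum_(k < (m * e).+1) 1 :> R.
  by rewrite sumr_const card_ord.
apply: ler_sum => k _.
apply: le_trans (_ : \sum_(U in msets n k) (n%:R ^+ k)^-1 <= _).
  rewrite big_mkcond [leRHS]big_mkcond; apply: ler_sum => U _.
  rewrite inE; case: ifP => [/andP[Ue /eqP <-]|_].
    by rewrite inordK // eqxx.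
  by case: ifP => // _; rewrite invr_ge0 exprn_ge0.
rewrite sumr_const -[leLHS]mulr_natl ler_pdivrMr ?exprn_gt0 // mul1r -natrX.
rewrite ler_nat.
apply: leq_trans (bin_le_exp _ _).
by rewrite -[n in 'C(n, _)]card_ord -card_draws.
Qed.

Lemma covered_copies_moment (m v e : nat) :
  (forall EC : {set {set 'I_n}} * {set {set 'I_n}}, clique_covered m v e EC ->
     p ^+ #|clique_edges EC.2| * n%:R ^+ #|cover EC.2|.+1
       <= p ^+ 'C(m, 2) * n%:R ^+ m) ->
  gnp_expect p (fun G : sgraph 'I_n => #|covered_copies m v e G|%:R)
  <= ((m * e).+1 * (2 ^ 2 ^ (m * e) * 2 ^ 2 ^ (m * e)))%:R
     * (p ^+ 'C(m, 2) * n%:R ^+ m) / n%:R.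
Proof.
move=> gap; have nR : 0 < n%:R :> R by rewrite ltr0n.
rewrite gnp_expect_covered //.
apply: le_trans (_ : \sum_(EC | clique_covered m v e EC)
   (n%:R ^+ #|cover (EC.2 : {set {set 'I_n}})|)^-1 *
   (p ^+ 'C(m, 2) * n%:R ^+ m / n%:R) <= _).
  apply: ler_sum => EC /gap; rewrite exprSr mulrA.
  rewrite -ler_pdivlMr // -ler_pdivlMr ?exprn_gt0 // => /le_trans; apply.
  by rewrite mulrC.
rewrite -mulr_suml -[leRHS]mulrA ler_wpM2r ?sum_clique_covered //.
by case/andP: p01 => p0 _; rewrite !mulr_ge0 ?exprn_ge0 ?invr_ge0.
Qed.

(** Cliques sharing at most one vertex have no common pair, so their covariance vanishes. If they
    share [j >= 2] vertices, it is at most [q ^+ 2 / p ^+ 'C(j, 2)], hence at most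
    [q ^+ 2 * n ^ j / B]; these terms are summed by [sum_exp_card_meet]. *)
Lemma cliques_variance (m : nat) (B : R) : 0 < p -> 0 < B ->
  (forall j, (2 <= j <= m)%N -> B <= n%:R ^+ j * p ^+ 'C(j, 2)) ->
  gnp_expect p (fun G : sgraph 'I_n =>
    (#|cliques m G|%:R - 'C(n, m)%:R * p ^+ 'C(m, 2)) ^+ 2)
  <= 'C(n, m)%:R * p ^+ 'C(m, 2) ^+ 2 * (2 ^ m * n ^ m)%:R / B.
Proof.
move=> p0 B0 hB; set mu := 'C(n, m)%:R * _; set q := p ^+ 'C(m, 2).
have q0 : 0 < q by rewrite exprn_gt0.
have -> : gnp_expect p (fun G : sgraph 'I_n => (#|cliques m G|%:R - mu) ^+ 2)
   = gnp_expect p (fun G : sgraph 'I_n => #|cliques m G|%:R ^+ 2) - mu ^+ 2.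
  transitivity (gnp_expect p (fun G : sgraph 'I_n => (#|cliques m G|%:R ^+ 2
    + ((- 2 * mu) * #|cliques m G|%:R)) + mu ^+ 2)).
    by apply: eq_bigr => G _; congr (_ * _); ring.
  rewrite !gnp_expectD gnp_expectZ gnp_expect_cst gnp_expect_cliques //.
  by rewrite -/mu; ring.
rewrite gnp_expect_cliques2 //.
have cm : #|msets n m| = 'C(n, m) by rewrite -[n in RHS]card_ord -card_draws.
have -> : mu ^+ 2 = \sum_(K in msets n m) \sum_(L in msets n m) q ^+ 2.
  by rewrite !sumr_const cm -mulrnA -[RHS]mulr_natl natrM /mu -/q; ring.
rewrite -sumrB; apply: le_trans (_ : \sum_(K in msets n m)
    q ^+ 2 * (2 ^ m * n ^ m)%:R / B <= _); last first.
  by rewrite sumr_const cm -[leLHS]mulr_natl !mulrA lexx.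
apply: ler_sum => K; rewrite inE => /eqP Km; rewrite -sumrB.
apply: le_trans (_ : \sum_(L in msets n m)
    q ^+ 2 * (n ^ #|K :&: L|)%:R / B <= _).
  apply: ler_sum => L; rewrite inE => /eqP Lm.
  have jm : (#|K :&: L| <= m)%N by rewrite -Km subset_leq_card ?subsetIl.
  have eKL : p ^+ #|pairs K :|: pairs L| * p ^+ 'C(#|K :&: L|, 2) = q ^+ 2.
    by rewrite -exprD -card_pairs pairsI cardsUI !card_pairs Km Lm exprD expr2.
  have [j2|j2] := leqP 2 #|K :&: L|; last first.
    have : p ^+ #|pairs K :|: pairs L| = q ^+ 2.
      by rewrite -eKL bin_small // mulr1.
    by move=> ->; rewrite subrr !mulr_ge0 ?ler0n ?invr_ge0 ?ltW ?exprn_gt0.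
  apply: le_trans (_ : p ^+ #|pairs K :|: pairs L| <= _).
    by rewrite gerDl oppr_le0 exprn_ge0 ?ltW.
  rewrite ler_pdivlMr // -eKL -mulrA ler_pM2l ?exprn_gt0 // mulrC natrX.
  by rewrite hB // j2 jm.
rewrite -mulr_suml -mulr_sumr ler_pM2r ?invr_gt0 //.
rewrite ler_pM2l ?exprn_gt0 // -natr_sum ler_nat.
by have := sum_exp_card_meet K; rewrite Km.
Qed.

End Moments.

(** * Error probability for a fixed number of vertices *)

Section Deviation.
Variables (R : realType) (n m v0 e0 : nat) (p u B : R).
Hypotheses (p01 : 0 <= p <= 1) (m3 : (3 <= m)%N) (mn : (m.*2 <= n)%N).
Hypotheses (e0_gt0 : (0 < e0)%N) (B1 : 1 <= B).
Let mu := 'C(n, m)%:R * p ^+ 'C(m, 2).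
Hypothesis mu_ge : B ^+ m <= mu.
Hypotheses (u0 : 0 < u) (pu : p * u <= 1).
Hypothesis gap : forall N vF : nat, (v0 <= vF)%N ->
  (m.+1 * vF <= 2 * N + m.+1 * v0)%N ->
  (m.+1 * vF <= 2 * (e0 + N) + m.+1 * (2 * N))%N ->
  n%:R ^+ vF.+1 <= u ^+ (e0 + N).

Let n_gt0 : (0 < n)%N.
Proof. by lia. Qed.

Let nR : 0 < n%:R :> R.
Proof. by rewrite ltr0n. Qed.

Let B0 : 0 < B.
Proof. exact: lt_le_trans B1. Qed.

Let mu0 : 0 < mu.
Proof. by apply: lt_le_trans mu_ge; rewrite exprn_gt0. Qed.

Let p0 : 0 < p.
Proof.
have [p0 _] := andP p01; rewrite lt_def p0 andbT; apply: contraTneq mu0 => pE.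
rewrite /mu pE expr0n; case: eqP => [C0|_]; last by rewrite mulr0 ltxx.
by have := bin_gt0 m 2; rewrite C0 (ltnW m3).
Qed.

Let mu_le : mu <= n%:R ^+ m * p ^+ 'C(m, 2).
Proof.
by rewrite ler_wpM2r ?exprn_ge0 ?(ltW p0) // -natrX ler_nat bin_le_exp.
Qed.

(* (n^j p^C(j,2))^m >= (n^m p^C(m,2))^j since (j-1)/2 <= (m-1)/2. *)
Lemma subclique_expect_ge j : (2 <= j <= m)%N -> B <= n%:R ^+ j * p ^+ 'C(j, 2).
Proof.
case/andP=> j2 jm; have j0 : (0 < j)%N by exact: ltnW.
have m0 : (0 < m)%N by exact: leq_trans m3.
have x0 : 0 <= n%:R ^+ j * p ^+ 'C(j, 2).
  by rewrite mulr_ge0 ?exprn_ge0 ?(ltW p0).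
rewrite -(ler_pXn2r m0) ?nnegrE ?(ltW B0) //.
have Y1 : 1 <= n%:R ^+ m * p ^+ 'C(m, 2).
  by apply: le_trans mu_le; apply: le_trans mu_ge; rewrite exprn_ege1.
apply: le_trans (_ : (n%:R ^+ m * p ^+ 'C(m, 2)) ^+ j <= _).
  apply: le_trans (_ : (n%:R ^+ m * p ^+ 'C(m, 2)) ^+ 1 <= _).
    by rewrite expr1 (le_trans mu_ge).
  by rewrite ler_weXn2l.
rewrite !exprMn -!exprM [(m * j)%N]mulnC ler_pM2l ?exprn_gt0 //.
have bin2E k : ('C(k, 2) * 2 = k * k.-1)%N.
  by rewrite mulnC -mul_bin_diag bin1.
have [_ p1] := andP p01; rewrite ler_wiXn2l ?(ltW p0) //.
rewrite -(leq_pmul2r (isT : 0 < 2)%N) mulnAC bin2E [leqRHS]mulnAC bin2E.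
rewrite mulnAC [leqRHS]mulnAC [(m * j)%N]mulnC.
by rewrite leq_mul2l -!subn1 leq_sub2r ?orbT.
Qed.

(** Here [u] is a lower bound for [1 / p], later a power of [n]. By [gap] the left side is at most a
    power of [p * u <= 1]. Its exponent may be lowered to ['C(m, 2)], as [C] contains a clique, and
    [u ^+ 'C(m, 2) <= n ^ m] because [n ^ m * p ^+ 'C(m, 2)] is at least one. *)
Lemma clique_covered_gap (EC : {set {set 'I_n}} * {set {set 'I_n}}) :
  clique_covered m v0 e0 EC ->
  p ^+ #|clique_edges EC.2| * n%:R ^+ #|cover EC.2|.+1
    <= p ^+ 'C(m, 2) * n%:R ^+ m.
Proof.
case: EC => E C /and4P[/=].
move=> /and4P[/eqP Ee /eqP Ev /forall_inP E2 /forall_inP Efree] _.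
move=> /forall_inP CK /forall_inP EC.
have E2' e : e \in E -> #|e| = 2 by move=> /E2 /eqP.
have CK' K : K \in C -> [/\ #|K| = m, ~~ (pairs K \subset E) &
    exists2 e, e \in E & e \subset K].
  move=> /CK /andP[Km /existsP[e /andP[eE eK]]]; split; first exact/eqP.
    exact: Efree.
  by exists e.
have EC' e : e \in E -> exists2 K, K \in C & e \subset K.
  by move=> /EC /existsP[K /andP[KC eK]]; exists K.
have [cC c1 c2 c3] := covered_cliques_count E2' CK' EC'.
rewrite Ev in c1 c2; rewrite Ee in cC c3.
have {c1 c2 c3} := gap c1 c2 c3; rewrite -cC => gapC.
have Cle : ('C(m, 2) <= #|clique_edges C|)%N.
  have /card_gt0P[f fE] : (0 < #|E|)%N by rewrite Ee.
  have [K KC _] := EC' f fE; have [Km _ _] := CK' K KC.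
  by rewrite -Km -card_pairs subset_leq_card // (bigcup_sup K).
apply: le_trans (_ : p ^+ #|clique_edges C| * u ^+ #|clique_edges C| <= _).
  by rewrite ler_wpM2l // exprn_ge0 // (ltW p0).
have pu0 : 0 <= p * u by rewrite mulr_ge0 ?(ltW p0) ?(ltW u0).
apply: le_trans (_ : p ^+ 'C(m, 2) * u ^+ 'C(m, 2) <= _).
  by rewrite -!exprMn ler_wiXn2l.
rewrite ler_wpM2l ?exprn_ge0 ?(ltW p0) //.
have Y1 : 1 <= n%:R ^+ m * p ^+ 'C(m, 2).
  by apply: le_trans mu_le; apply: le_trans mu_ge; rewrite exprn_ege1.
apply: le_trans (_ : n%:R ^+ m * p ^+ 'C(m, 2) * u ^+ 'C(m, 2) <= _).
  by rewrite ler_peMl // exprn_ge0 // (ltW u0).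
by rewrite -mulrA -exprMn ler_piMr ?exprn_ge0 ?exprn_ile1.
Qed.

Variables (V : finType) (H H0 : sgraph V).
Hypothesis H0H : subgraph H0 H.
Hypothesis sparse : forall S S' : sgraph 'I_n, S' \in copies H0 S ->
  sparse_edge_set m v0 e0 (edges S').

(** The bound of [sum_clique_covered] for [e0] edges; it does not depend on [n]. *)
Definition deviation_const : nat :=
  ((m * e0).+1 * (2 ^ 2 ^ (m * e0) * 2 ^ 2 ^ (m * e0)))%N.

(** The first error term is Chebyshev's inequality for the number of cliques, the second Markov's
    inequality for the number of configurations, each destroying at most [e0] cliques. Each source
    may cost half of the tolerance [eps * mu]. *)
Lemma ex_copies_deviation (eps : R) : 0 < eps ->
  1 - (4 * 2 ^ m * (2 ^ m * m`!))%:R / (B * eps ^+ 2)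
    - (2 * e0 * deviation_const * (2 ^ m * m`!))%:R / (n%:R * eps)
  <= gnp_prob p (fun G : sgraph 'I_n =>
       `|(ex_copies G (complete 'I_m) H)%:R - mu| <= eps * mu).
Proof.
move=> eps0; pose X (G : sgraph 'I_n) : R := #|cliques m G|%:R.
pose W (G : sgraph 'I_n) : R := #|covered_copies m v0 e0 G|%:R.
have e0R : 0 < e0%:R :> R by rewrite ltr0n.
pose t := eps / 2 * mu.
have t0 : 0 < t by rewrite mulr_gt0 // divr_gt0.
apply: le_trans (@gnp_prob_ge R n p p01 _
  (fun G => t ^+ 2 <= (X G - mu) ^+ 2) (fun G => t / e0%:R <= W G) _);
  last first.
  move=> G vG.
  rewrite -!ltNge => hX hW.
  have {}hX : `|X G - mu| < t.
    rewrite -(ltr_pXn2r (isT : 0 < 2)%N) ?nnegrE ?normr_ge0 ?(ltW t0) //.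
    by rewrite real_normK // num_real.
  have {}hW : W G * e0%:R < t by rewrite -ltr_pdivlMr.
  have h1 : (ex_copies G (complete 'I_m) H)%:R <= X G.
    rewrite ler_nat -card_copies_complete; last exact: ltnW.
    exact: ex_copies_le.
  have h2 : X G <= (ex_copies G (complete 'I_m) H)%:R + W G * e0%:R.
    rewrite -natrM -natrD ler_nat.
    by apply: ex_copies_ge H0H vG sparse => //; exact: ltnW.
  have te : eps * mu = t + t by rewrite /t; field.
  move: hX; rewrite ltr_norml => /andP[hX1 hX2].
  by rewrite ler_norml te; apply/andP; split; lra.
(* The moment bounds contain [n ^ m]; this trades it for the binomial coefficient, so that [mu]
   cancels. *)
have Cn : n%:R ^+ m <= (2 ^ m * m`!)%:R * 'C(n, m)%:R :> R.
  by rewrite -natrX -natrM ler_nat exp_le_bin.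
have C0 : 0 < 'C(n, m)%:R :> R.
  by rewrite ltr0n bin_gt0 (leq_trans _ mn) // -addnn leq_addr.
set q := p ^+ 'C(m, 2); have q0 : 0 < q by rewrite exprn_gt0.
have D1 : gnp_prob p (fun G => t ^+ 2 <= (X G - mu) ^+ 2)
    <= (4 * 2 ^ m * (2 ^ m * m`!))%:R / (B * eps ^+ 2).
  apply: le_trans (gnp_prob_markov p01 _ _) _; first by rewrite exprn_gt0.
    by move=> G; rewrite sqr_ge0.
  rewrite ler_pdivrMr ?exprn_gt0 //.
  apply: le_trans (cliques_variance p0 B0 subclique_expect_ge) _.
  rewrite -/q natrM natrX [(n ^ m)%:R]natrX.
  apply: le_trans (_ : 'C(n, m)%:R * q ^+ 2 *
    (2 ^+ m * ((2 ^ m * m`!)%:R * 'C(n, m)%:R)) / B <= _).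
    rewrite ler_pM2r ?invr_gt0 // ler_pM2l ?mulr_gt0 ?exprn_gt0 //.
    by rewrite ler_pM2l ?exprn_gt0.
  rewrite le_eqVlt; apply/orP; left; apply/eqP.
  rewrite /t /mu -/q; move: (2 ^ m * m`!)%N => k; rewrite !natrM natrX.
  by field; rewrite !gt_eqF.
have D2 : gnp_prob p (fun G => t / e0%:R <= W G)
    <= (2 * e0 * deviation_const * (2 ^ m * m`!))%:R / (n%:R * eps).
  apply: le_trans (gnp_prob_markov p01 _ _) _; first by rewrite divr_gt0.
    by move=> G; rewrite ler0n.
  rewrite ler_pdivrMr ?divr_gt0 //.
  apply: le_trans (covered_copies_moment p01 n_gt0 clique_covered_gap) _.
  rewrite -/deviation_const -/q; move: deviation_const => k.
  apply: le_trans
    (_ : k%:R * (q * ((2 ^ m * m`!)%:R * 'C(n, m)%:R)) / n%:R <= _).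
    by rewrite ler_pM2r ?invr_gt0 // ler_wpM2l // ler_pM2l.
  rewrite le_eqVlt; apply/orP; left; apply/eqP.
  rewrite /t /mu -/q; move: (2 ^ m * m`!)%N => k'; rewrite !natrM.
  by field; rewrite !gt_eqF.
lra.
Qed.

End Deviation.

(* Passage to the limit *)
From mathcomp Require Import all_classical all_reals all_analysis.

Unset Implicit Arguments.
Import numFieldNormedType.Exports.

Local Open Scope classical_set_scope.

Theorem theorem1p4 (R : realType) (m : nat) (hm : (3 <= m)%N) (c : R)
    (hc : c < m2 R (complete 'I_m)) :
  exists (M : nat) (delta : R), 0 < delta /\
    forall (V : finType) (H : sgraph V),
      chromatic_number H = m.+1 ->
      m2 R H < c ->
      (exists H0 : sgraph V,
        [/\ subgraph H0 H, (3 <= #|verts H0|)%N,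
            density2 R H0 = m2 R H & (M < #|verts H0|)%N]) ->
    forall p : nat -> R,
      (forall n, 0 <= p n <= 1) ->
      (\forall n \near \oo, p n <= n%:R `^ (- (1 / m2 R H) + delta)) ->
      'C(n, m)%:R * p n ^+ 'C(m, 2) @[n --> \oo] --> +oo ->
      whp_asymptotic p
        (fun n G => (ex_copies G (complete 'I_m) H)%:R)
        (fun n => 'C(n, m)%:R * p n ^+ 'C(m, 2)).
Proof.
have mR : 3 <= m%:R :> R by rewrite (ler_nat _ 3).
(* [exponent_gap] wants a positive bound, while [c] may be nonpositive; raising it to [1] keeps it
   below [(m + 1) / 2], as [m] is at least 3. *)
have c1 : Num.max c 1 < (m%:R + 1) / 2.
  by rewrite gt_max -m2_complete // hc m2_complete //; lra.
have [|M [delta [delta0 gapP]]] := exponent_gap _ c1.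
  by rewrite lt_max ltr01 orbT.
exists M, delta; split=> // V H chiH m2c [H0 [H0H v3 densE Mv]] p p01 ple mu_oo.
have H2 : (1 < #|edges H|)%N by rewrite chromatic_number_gt2 // chiH leqW.
have m2K : m2 R H < m2 R (complete 'I_m) by exact: lt_trans hc.
have d0 := m2_gt0 R H2 H0H v3.
have e_gt0 := card_edges_densest_gt0 H2 H0H v3 densE.
have sparse := sparse_copy hm H2 m2K H0H v3 densE.
pose e0 := #|edges H0|.
move=> eps eps0; apply/cvgrPdist_le => /= t t0.
pose K1 : R := (4 * 2 ^ m * (2 ^ m * m`!))%:R.
pose K2 : R := (2 * e0 * deviation_const m e0 * (2 ^ m * m`!))%:R.
(* A constant large enough to bring the Chebyshev term below [t / 2]; [B ^+ m] is eventually
   exceeded by the diverging expectation. *)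
pose B := Num.max 1 (2 * K1 / (t * eps ^+ 2)).
have B1 : 1 <= B by rewrite le_max lexx.
have teps : 0 < t * eps ^+ 2 by rewrite mulr_gt0 ?exprn_gt0.
near=> n.
have pn01 := p01 n.
have nm : (m.*2 <= n)%N by near: n; exact: nbhs_infty_ge.
have n0 : (0 < n)%N.
  by apply: leq_trans nm; rewrite -addnn addn_gt0 (leq_trans _ hm).
have n1R : 1 <= n%:R :> R by rewrite (ler_nat _ 1).
have muB : B ^+ m <= 'C(n, m)%:R * p n ^+ 'C(m, 2).
  by near: n; exact: (cvgryPge _).1 mu_oo (B ^+ m).
(* The hypothesis on [p] reads [p n <= n ^ -a], so [u] is taken to be [n ^ a]. *)
pose a := 1 / m2 R H - delta.
have u0 : 0 < n%:R `^ a by rewrite powR_gt0 // ltr0n.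
have pu : p n * n%:R `^ a <= 1.
  rewrite -ler_pdivlMr // div1r -powRN /a opprB addrC.
  by near: n.
have gap N vF : (#|verts H0| <= vF)%N ->
    (m.+1 * vF <= 2 * N + m.+1 * #|verts H0|)%N ->
    (m.+1 * vF <= 2 * (e0 + N) + m.+1 * (2 * N))%N ->
    n%:R ^+ vF.+1 <= (n%:R `^ a) ^+ (e0 + N).
  move=> h1 h2 h3.
  have dc : m2 R H < Num.max c 1 by rewrite lt_max m2c.
  have eq_e := card_edges_densest v3 densE.
  have [a0 aN] := gapP _ _ _ _ _ d0 dc Mv v3 eq_e h1 h2 h3.
  rewrite -powR_mulrn // -powR_mulrn ?powR_ge0 // -powRrM.
  by rewrite ler_powR // -natr1.
have := ex_copies_deviation pn01 hm nm e_gt0 B1 muB u0 pu gap H0H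
  (fun S S' => @sparse _ S S') eps0.
rewrite -/e0 -/K1 -/K2 => dev.
rewrite ger0_norm ?subr_ge0 ?gnp_prob_le1 // lerBlDr -lerBlDl.
apply: le_trans dev.
have B0 : 0 < B by exact: lt_le_trans B1.
have K1t : K1 / (B * eps ^+ 2) <= t / 2.
  rewrite ler_pdivrMr ?mulr_gt0 ?exprn_gt0 //.
  have : 2 * K1 / (t * eps ^+ 2) <= B by rewrite le_max lexx orbT.
  rewrite ler_pdivrMr //; lra.
(* The Markov term decays like [1 / n], thanks to the spare factor of [n] in [gap]. *)
have K2t : K2 / (n%:R * eps) <= t / 2.
  have : 2 * K2 / (t * eps) <= n%:R by near: n; exact: nbhs_infty_ger.
  rewrite !ler_pdivrMr ?mulr_gt0 ?ltr0n //; lra.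
lra.
Unshelve. all: by end_near.
Qed.
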